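(* Let $n\ge 1$ and let $\Bbbk$ be a field. For every $1\le k\le n$, let $J_k$ be the $\mathcal{J}$-class of $\mathrm{OD}_n$ consisting of the functions whose image has size $k$. Then the sandwich matrix $P$ of $J_k$ is right invertible over $\Bbbk G_{J_k}$.
   Context: $[n]=\{1,\dots,n\}$, and $\mathrm{OD}_n$ is the monoid (under composition, $(fg)(x)=f(g(x))$) of all functions $f:[n]\to[n]$ that are order-preserving or order-reversing. It is a regular monoid: two elements are $\mathcal{R}$-related iff they have the same image, $\mathcal{L}$-related iff they have the same kernel (fibre partition), $\mathcal{J}$-related iff their images have the same size; $\mathcal{H}=\mathcal{R}\cap\mathcal{L}$. Sandwich matrix: let $J$ be a regular $\mathcal{J}$-class of a finite monoid, with $\mathcal{R}$-classes $R_i$ ($i\in I$) and $\mathcal{L}$-classes $L_\lambda$ ($\lambda\in\Lambda$), and let $H_{i,\lambda}=R_i\cap L_\lambda$. An $\mathcal{H}$-class contains an idempotent iff it is a (maximal) subgroup; all group $\mathcal{H}$-classes in $J$ are isomorphic to a group denoted $G_J$. Index so that $1\in I$, $1\in\Lambda$ and $H_{1,1}\simeq G_J$ is a group. Choose representatives $a_i\in H_{i,1}$ for $i\in I$ and $b_\lambda\in H_{1,\lambda}$ for $\lambda\in\Lambda$, with $a_1=b_1$ the identity of $H_{1,1}$. The sandwich matrix $P_J$ is the $\Lambda\times I$ matrix over $G_J\cup\{0\}$ with $[P_J]_{\lambda,i}=b_\lambda a_i$ if $H_{i,\lambda}$ contains an idempotent (in this case $b_\lambda a_i\in H_{1,1}$),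 and $0$ otherwise. Right invertible over $\Bbbk G_J$ means that there is an $I\times\Lambda$ matrix $N$ over the group algebra $\Bbbk G_J$ with $P_JN$ equal to the identity $\Lambda\times\Lambda$ matrix; this property does not depend on the choice of representatives. *)

(* Defs.v *)
From HB Require Import structures.
From mathcomp Require Import all_boot all_order all_fingroup all_algebra.
From mathcomp Require Import zify.
Set Implicit Arguments. Unset Strict Implicit. Unset Printing Implicit Defensive.
Import Order.TTheory GRing.Theory.

(* A bare class is used because the class of finite monoids cannot be declared
   above the already loaded class of finite star-monoids. *)
HB.mixin Record Finite_isFinMonoid M of Finite M := {
  mulm : M -> M -> M;
  onem : M;
  mulmA : associative mulm;
  mul1m : left_id onem mulm;
  mulm1 : right_id onem mulm
}.

#[short(type="finMonoidType")]
HB.structure Definition FinMonoid := {M of Finite_isFinMonoid M & Finite M}.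

Declare Scope finmonoid_scope.
Notation "x * y" := (mulm x y) : finmonoid_scope.
Notation "1" := (@onem _) : finmonoid_scope.
Local Open Scope finmonoid_scope.

Definition right_ideal (M : finMonoidType) (x : M) : {set M} :=
  [set x * s | s in M].
Definition left_ideal (M : finMonoidType) (x : M) : {set M} :=
  [set s * x | s in M].
Definition two_sided_ideal (M : finMonoidType) (x : M) : {set M} :=
  [set s * x * t | s in M, t in M].

Definition greenR (M : finMonoidType) (x y : M) : bool :=
  right_ideal x == right_ideal y.
Definition greenL (M : finMonoidType) (x y : M) : bool :=
  left_ideal x == left_ideal y.
Definition greenJ (M : finMonoidType) (x y : M) : bool :=
  two_sided_ideal x == two_sided_ideal y.
Definition greenH (M : finMonoidType) (x y : M) : bool :=
  greenR x y && greenL x y.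

Definition Rclass (M : finMonoidType) (x : M) : {set M} := [set y | greenR x y].
Definition Lclass (M : finMonoidType) (x : M) : {set M} := [set y | greenL x y].
Definition Jclass (M : finMonoidType) (x : M) : {set M} := [set y | greenJ x y].

Definition Rclasses (M : finMonoidType) (J : {set M}) : {set {set M}} :=
  [set Rclass x | x in J].
Definition Lclasses (M : finMonoidType) (J : {set M}) : {set {set M}} :=
  [set Lclass x | x in J].

Definition has_idempotent (M : finMonoidType) (A : {set M}) : bool :=
  [exists x in A, x * x == x].

Section GreenTheory.
Context (M : finMonoidType).
Implicit Types x y z s t e : M.

Lemma mem_right_ideal x : x \in right_ideal x.
Proof. by apply/imsetP; exists 1; rewrite ?mulm1. Qed.
Lemma mem_left_ideal x : x \in left_ideal x.
Proof. by apply/imsetP; exists 1; rewrite ?mul1m. Qed.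
Lemma mem_two_sided_ideal x : x \in two_sided_ideal x.
Proof. by apply/imset2P; exists 1 1; rewrite ?mul1m ?mulm1. Qed.

Lemma greenRP x y :
  reflect ((exists s, y = x * s) /\ (exists t, x = y * t)) (greenR x y).
Proof.
apply: (iffP eqP) => [eq_xy | [[s ys] [t xt]]].
  split.
    by have := mem_right_ideal y; rewrite -eq_xy => /imsetP[s _ ->]; exists s.
  by have := mem_right_ideal x; rewrite eq_xy => /imsetP[s _ ->]; exists s.
apply/eqP; rewrite eqEsubset; apply/andP; split; apply/subsetP=> z /imsetP[u _ ->].
  by rewrite xt; apply/imsetP; exists (t * u); rewrite ?mulmA.
by rewrite ys; apply/imsetP; exists (s * u); rewrite ?mulmA.
Qed.

Lemma greenLP x y :
  reflect ((exists s, y = s * x) /\ (exists t, x = t * y)) (greenL x y).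
Proof.
apply: (iffP eqP) => [eq_xy | [[s ys] [t xt]]].
  split.
    by have := mem_left_ideal y; rewrite -eq_xy => /imsetP[s _ ->]; exists s.
  by have := mem_left_ideal x; rewrite eq_xy => /imsetP[s _ ->]; exists s.
apply/eqP; rewrite eqEsubset; apply/andP; split; apply/subsetP=> z /imsetP[u _ ->].
  by rewrite xt; apply/imsetP; exists (u * t); rewrite ?mulmA.
by rewrite ys; apply/imsetP; exists (u * s); rewrite ?mulmA.
Qed.

Lemma greenJP x y :
  reflect ((exists s t, y = s * x * t) /\ (exists s t, x = s * y * t))
          (greenJ x y).
Proof.
apply: (iffP eqP) => [eq_xy | [[s [t yst]] [u [v xuv]]]].
  split.
    have := mem_two_sided_ideal y.
    by rewrite -eq_xy => /imset2P[s t _ _ ->]; exists s, t.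
  have := mem_two_sided_ideal x.
  by rewrite eq_xy => /imset2P[s t _ _ ->]; exists s, t.
apply/eqP; rewrite eqEsubset; apply/andP.
split; apply/subsetP=> z /imset2P[p q _ _ ->].
  by rewrite xuv; apply/imset2P; exists (p * u) (v * q); rewrite ?mulmA.
by rewrite yst; apply/imset2P; exists (p * s) (t * q); rewrite ?mulmA.
Qed.

Lemma greenR_refl x : greenR x x. Proof. exact: eqxx. Qed.
Lemma greenL_refl x : greenL x x. Proof. exact: eqxx. Qed.
Lemma greenR_sym x y : greenR x y = greenR y x. Proof. exact: eq_sym. Qed.
Lemma greenL_sym x y : greenL x y = greenL y x. Proof. exact: eq_sym. Qed.
Lemma greenR_trans x y z : greenR x y -> greenR y z -> greenR x z.
Proof. by move=> /eqP xy /eqP yz; rewrite /greenR xy yz. Qed.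
Lemma greenL_trans x y z : greenL x y -> greenL y z -> greenL x z.
Proof. by move=> /eqP xy /eqP yz; rewrite /greenL xy yz. Qed.

Lemma idem_greenR e x : e * e = e -> greenR e x -> e * x = x.
Proof. by move=> ee /greenRP[[s ->] _]; rewrite mulmA ee. Qed.
Lemma idem_greenL e x : e * e = e -> greenL e x -> x * e = x.
Proof. by move=> ee /greenLP[[s ->] _]; rewrite -mulmA ee. Qed.

Lemma greenH_mul x y :
  has_idempotent (Rclass x :&: Lclass y) ->
  greenR y (y * x) /\ greenL x (y * x).
Proof.
case/existsP=> f /andP[]; rewrite !inE => /andP[xRf yLf] /eqP ff.
have fx : f * x = x by apply: idem_greenR => //; rewrite greenR_sym.
have yf : y * f = y by apply: idem_greenL => //; rewrite greenL_sym.
have [[t ft] _] := greenRP _ _ xRf; have [[s fs] _] := greenLP _ _ yLf.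
split; [apply/greenRP | apply/greenLP]; split.
- by exists x.
- by exists t; rewrite -mulmA -ft yf.
- by exists y.
- by exists s; rewrite mulmA -fs fx.
Qed.

End GreenTheory.

Record idempotent_of (M : finMonoidType) := Idempotent {
  idem_val :> M;
  idem_valP : idem_val * idem_val = idem_val
}.

Record max_subgroup (M : finMonoidType) (e : idempotent_of M) := MaxSubgroup {
  max_subgroup_val :> M;
  max_subgroup_valP : greenH e max_subgroup_val
}.

HB.instance Definition _ (M : finMonoidType) (e : idempotent_of M) :=
  [isSub for @max_subgroup_val M e].
HB.instance Definition _ (M : finMonoidType) (e : idempotent_of M) :=
  [Finite of max_subgroup e by <:].

Section MaxSubgroup.
Context (M : finMonoidType) (e : idempotent_of M).
Implicit Types x y z : max_subgroup e.

Lemma max_subgroup_mul1 x : e * x = x :> M.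
Proof. by case/andP: (valP x) => R _; apply: idem_greenR R; apply: idem_valP. Qed.

Lemma max_subgroup_mulr1 x : x * e = x :> M.
Proof. by case/andP: (valP x) => _ L; apply: idem_greenL L; apply: idem_valP. Qed.

Lemma max_subgroup_mul_proof x y : greenH e ((x : M) * (y : M)).
Proof.
case/andP: (valP x) => Rx Lx; case/andP: (valP y) => Ry Ly.
have [] := @greenH_mul M y x.
  apply/existsP; exists (e : M); rewrite !inE greenR_sym Ry greenL_sym Lx /=.
  exact/eqP/idem_valP.
move=> R L; rewrite /greenH (greenR_trans Rx R); exact: greenL_trans Ly L.
Qed.

Definition max_subgroup_mul x y := MaxSubgroup (max_subgroup_mul_proof x y).

Lemma max_subgroup_one_proof : greenH e e.
Proof. by rewrite /greenH greenR_refl greenL_refl. Qed.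

Definition max_subgroup_one := MaxSubgroup max_subgroup_one_proof.

Lemma max_subgroup_inv_proof x :
  exists y, max_subgroup_mul y x == max_subgroup_one.
Proof.
case/andP: (valP x) => /greenRP[_ [t et]] /greenLP[_ [s es]].
have xe := max_subgroup_mulr1 x; have ex := max_subgroup_mul1 x.
have ee := idem_valP e.
pose y := e * t * e.
have xy : x * y = e by rewrite /y !mulmA xe -et ee.
have yx : y * x = e.
  by rewrite /y -(mulmA _ _ (x : M)) ex {1}es -(mulmA s) -et -mulmA ex -es.
have eHy : greenH e y.
  apply/andP; split; [apply/greenRP | apply/greenLP]; split.
  - by exists (t * e); rewrite mulmA.
  - by exists (x : M).
  - by exists (e * t).
  - by exists (x : M).
by exists (MaxSubgroup eHy); apply/eqP/val_inj.
Qed.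

Definition max_subgroup_inv x := xchoose (max_subgroup_inv_proof x).

Lemma max_subgroup_mulA : associative max_subgroup_mul.
Proof. by move=> x y z; apply/val_inj; rewrite /= mulmA. Qed.
Lemma max_subgroup_mul1g : left_id max_subgroup_one max_subgroup_mul.
Proof. by move=> x; apply/val_inj; rewrite /= max_subgroup_mul1. Qed.
Lemma max_subgroup_mulVg :
  left_inverse max_subgroup_one max_subgroup_inv max_subgroup_mul.
Proof. by move=> x; apply/eqP/(xchooseP (max_subgroup_inv_proof x)). Qed.

HB.instance Definition _ := Finite_isGroup.Build (max_subgroup e)
  max_subgroup_mulA max_subgroup_mul1g max_subgroup_mulVg.

End MaxSubgroup.

Definition group_algebra (K : fieldType) (G : finGroupType) := {ffun G -> K}.

Section GroupAlgebra.
Context (K : fieldType) (G : finGroupType).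
Local Open Scope ring_scope.
Implicit Types p q r : group_algebra K G.

HB.instance Definition _ := GRing.Zmodule.on (group_algebra K G).

Definition galg_elt (g : G) : group_algebra K G := [ffun h => (h == g)%:R].

Definition galg_mul p q : group_algebra K G :=
  [ffun g => \sum_h p h * q (h^-1 * g)%g].

Lemma galg_mulA : associative galg_mul.
Proof.
move=> p q r; apply/ffunP=> g; rewrite !ffunE.
under eq_bigr do rewrite ffunE mulr_sumr.
under [RHS]eq_bigr do rewrite ffunE mulr_suml.
rewrite [RHS]exchange_big /=; apply: eq_bigr => u _.
rewrite [RHS](reindex_inj (mulgI u)) /=; apply: eq_bigr => v _.
by rewrite mulKg invMg mulgA mulrA.
Qed.

Lemma galg_mul1 : left_id (galg_elt 1%g) galg_mul.
Proof.
move=> p; apply/ffunP=> g; rewrite !ffunE (bigD1 1%g) //= big1 => [|h neq_h1].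
  by rewrite ffunE eqxx mul1r invg1 mul1g addr0.
by rewrite ffunE (negPf neq_h1) mul0r.
Qed.

Lemma galg_mulr1 : right_id (galg_elt 1%g) galg_mul.
Proof.
move=> p; apply/ffunP=> g; rewrite !ffunE (bigD1 g) //= big1 => [|h neq_hg].
  by rewrite ffunE mulVg eqxx mulr1 addr0.
by rewrite ffunE -(inj_eq (mulgI h)) mulKVg mulg1 eq_sym (negPf neq_hg) mulr0.
Qed.

Lemma galg_mulDl : left_distributive galg_mul +%R.
Proof.
move=> p q r; apply/ffunP=> g; rewrite !ffunE -big_split /=.
by apply: eq_bigr => h _; rewrite ffunE mulrDl.
Qed.

Lemma galg_mulDr : right_distributive galg_mul +%R.
Proof.
move=> p q r; apply/ffunP=> g; rewrite !ffunE -big_split /=.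
by apply: eq_bigr => h _; rewrite ffunE mulrDr.
Qed.

Lemma galg_1_neq0 : galg_elt 1%g != 0.
Proof.
by apply/eqP=> /ffunP/(_ 1%g)/eqP; rewrite !ffunE eqxx oner_eq0.
Qed.

HB.instance Definition _ := GRing.Zmodule_isNzRing.Build (group_algebra K G)
  galg_mulA galg_mul1 galg_mulr1 galg_mulDl galg_mulDr galg_1_neq0.

End GroupAlgebra.

(* The base classes R_1 and L_1 are those of the idempotent e, so that H_{1,1}
   is [max_subgroup e]; representatives are indexed by the classes themselves. *)
Record sandwich_reps (M : finMonoidType) (J : {set M}) (e : idempotent_of M)
    (a b : {set M} -> M) : Prop := SandwichReps {
  reps_a : forall R, R \in Rclasses J -> a R \in R :&: Lclass e;
  reps_b : forall L, L \in Lclasses J -> b L \in Rclass e :&: L;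
  reps_a1 : a (Rclass e) = e;
  reps_b1 : b (Lclass e) = e
}.

(* The default value of [insubd] is never used, by [sandwich_entry_in] below. *)
Definition sandwich_mx (K : fieldType) (M : finMonoidType) (J : {set M})
    (e : idempotent_of M) (a b : {set M} -> M) :
    'M[group_algebra K (max_subgroup e)]_(#|Lclasses J|, #|Rclasses J|) :=
  \matrix_(l, i)
    let L := enum_val l in let R := enum_val i in
    if has_idempotent (R :&: L)
    then galg_elt K (insubd (max_subgroup_one e) (b L * a R))
    else 0%R.

Lemma sandwich_entry_in (M : finMonoidType) (J : {set M}) (e : idempotent_of M)
    (a b : {set M} -> M) (R L : {set M}) :
    sandwich_reps J e a b -> R \in Rclasses J -> L \in Lclasses J ->
  has_idempotent (R :&: L) -> greenH e (b L * a R).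
Proof.
move=> hab RJ LJ; have := reps_b hab LJ; have := reps_a hab RJ.
case/imsetP: RJ => x _ ->; case/imsetP: LJ => y _ ->.
set u := a _; set v := b _; rewrite !inE => /andP[xRu eLu] /andP[eRv yLv] id_xy.
have [|vR uL] := @greenH_mul M u v.
  case/existsP: id_xy => f /andP[]; rewrite !inE => /andP[xRf yLf] ff.
  apply/existsP; exists f; rewrite !inE ff andbT.
  rewrite (greenR_trans _ xRf) 1?greenR_sym //.
  by rewrite (greenL_trans _ yLf) 1?greenL_sym.
by rewrite /greenH (greenR_trans eRv) // (greenL_trans eLu).
Qed.

Definition right_invertible (A : nzRingType) (m p : nat) (P : 'M[A]_(m, p)) :
    Prop :=
  exists N : 'M[A]_(p, m), (P *m N = 1%:M)%R.

Definition order_preserving (n : nat) (f : 'I_n -> 'I_n) : bool :=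
  [forall x : 'I_n, forall y : 'I_n, (x <= y)%N ==> (f x <= f y)%N].
Definition order_reversing (n : nat) (f : 'I_n -> 'I_n) : bool :=
  [forall x : 'I_n, forall y : 'I_n, (x <= y)%N ==> (f y <= f x)%N].

Record OD (n : nat) := MkOD {
  OD_fun :> {ffun 'I_n -> 'I_n};
  OD_funP : order_preserving OD_fun || order_reversing OD_fun
}.

HB.instance Definition _ (n : nat) := [isSub for @OD_fun n].
HB.instance Definition _ (n : nat) := [Finite of OD n by <:].

Definition OD_rank (n : nat) (f : OD n) : nat := #|[set f x | x : 'I_n]|.

Definition OD_J (n r : nat) : {set OD n} := [set f | OD_rank f == r].

Section OD.
Context (n : nat).
Implicit Types f g : OD n.

Lemma order_preservingP (f : 'I_n -> 'I_n) :
  reflect {homo f : x y / (x <= y)%N} (order_preserving f).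
Proof.
apply: (iffP forallP) => [h x y le_xy | h x].
  by have /forallP/(_ y)/implyP-> := h x.
by apply/forallP=> y; apply/implyP/h.
Qed.

Lemma order_reversingP (f : 'I_n -> 'I_n) :
  reflect {homo f : x y /~ (x <= y)%N} (order_reversing f).
Proof.
apply: (iffP forallP) => [h x y le_xy | h x].
  by have /forallP/(_ x)/implyP-> := h y.
by apply/forallP=> y; apply/implyP/h.
Qed.

Lemma OD_mul_proof f g :
  let h := [ffun x => f (g x)] in order_preserving h || order_reversing h.
Proof.
apply/orP; case/orP: (OD_funP f); case/orP: (OD_funP g).
- move=> /order_preservingP hg /order_preservingP hf; left.
  by apply/order_preservingP=> x y le_xy; rewrite !ffunE; apply/hf/hg.
- move=> /order_reversingP hg /order_preservingP hf; right.
  by apply/order_reversingP=> x y le_xy; rewrite !ffunE; apply/hf/hg.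
- move=> /order_preservingP hg /order_reversingP hf; right.
  by apply/order_reversingP=> x y le_xy; rewrite !ffunE; apply/hf/hg.
- move=> /order_reversingP hg /order_reversingP hf; left.
  by apply/order_preservingP=> x y le_xy; rewrite !ffunE; apply/hf/hg.
Qed.

Lemma OD_one_proof :
  let h := [ffun x : 'I_n => x] in order_preserving h || order_reversing h.
Proof.
by apply/orP; left; apply/order_preservingP=> x y le_xy; rewrite !ffunE.
Qed.

Definition OD_mul f g := MkOD (OD_mul_proof f g).
Definition OD_one := MkOD OD_one_proof.

Lemma OD_mulA : associative OD_mul.
Proof. by move=> f g h; apply/val_inj/ffunP=> x; rewrite !ffunE. Qed.
Lemma OD_mul1 : left_id OD_one OD_mul.
Proof. by move=> f; apply/val_inj/ffunP=> x; rewrite !ffunE. Qed.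
Lemma OD_mulr1 : right_id OD_one OD_mul.
Proof. by move=> f; apply/val_inj/ffunP=> x; rewrite !ffunE. Qed.

HB.instance Definition _ :=
  Finite_isFinMonoid.Build (OD n) OD_mulA OD_mul1 OD_mulr1.

Lemma OD_mulE f g x : (f * g) x = f (g x).
Proof. by rewrite ffunE. Qed.


Lemma OD_ext f g : f =1 g -> f = g.
Proof. by move=> eq_fg; apply/val_inj/ffunP. Qed.

Lemma OD_rank_mulr f g : OD_rank (f * g) <= OD_rank f.
Proof.
apply/subset_leq_card/subsetP=> z /imsetP[x _ ->].
by rewrite OD_mulE imset_f.
Qed.

Lemma OD_rank_mull f g : OD_rank (f * g) <= OD_rank g.
Proof.
rewrite /OD_rank; have -> : [set (f * g) x | x : 'I_n] = f @: [set g x | x : 'I_n].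
  by rewrite -imset_comp; apply: eq_imset => x; rewrite OD_mulE.
exact: leq_imset_card.
Qed.

Lemma OD_rank_gt0 f : 0 < n -> 0 < OD_rank f.
Proof. by move=> n_gt0; apply/card_gt0P; exists (f (Ordinal n_gt0)); apply: imset_f. Qed.

Lemma cap_proof r (x : 'I_n) : minn x r.-1 < n.
Proof. exact: leq_ltn_trans (geq_minl _ _) (ltn_ord x). Qed.

Lemma OD_cap_proof r : let h := [ffun x => Ordinal (cap_proof r x)] in
  order_preserving h || order_reversing h.
Proof.
by apply/orP; left; apply/order_preservingP=> x y le_xy; rewrite !ffunE /=; lia.
Qed.

Definition OD_cap r := MkOD (OD_cap_proof r).

Lemma OD_capE r x : OD_cap r x = minn x r.-1 :> nat.
Proof. by rewrite ffunE. Qed.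

Lemma OD_cap_idem r : OD_cap r * OD_cap r = OD_cap r.
Proof.
apply: OD_ext => x; apply/ord_inj; rewrite OD_mulE !OD_capE.
by rewrite -minnA minnn.
Qed.

Lemma OD_rank_cap r : 0 < r <= n -> OD_rank (OD_cap r) = r.
Proof.
case/andP=> r_gt0 le_rn; rewrite /OD_rank.
suff -> : [set OD_cap r x | x : 'I_n] = [set widen_ord le_rn y | y : 'I_r].
  by rewrite card_imset ?card_ord // => x y /(congr1 val) /= /val_inj.
apply/setP=> z; apply/imsetP/imsetP=> -[x _ ->].
  have lt_xr : minn x r.-1 < r by lia.
  by exists (Ordinal lt_xr); rewrite //; apply/ord_inj; rewrite OD_capE.
exists (widen_ord le_rn x) => //; apply/ord_inj; rewrite OD_capE /=.
by have := ltn_ord x; lia.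
Qed.

Lemma OD_factor f : 0 < n -> exists s g : OD n,
  f * s * g * f = f /\ g * f * s = OD_cap (OD_rank f).
Proof.
move=> n_gt0; set k := OD_rank f; have k_gt0 : 0 < k by apply: OD_rank_gt0.
pose A := [set f x | x : 'I_n].
pose below (x : 'I_n) := [set y in A | y < x].
have below_lt x : #|below x| <= x.
  have -> : (x : nat) = #|[set y : 'I_n | y < x]|.
    rewrite -sum1_card (eq_bigl (fun y : 'I_n => y < x)); last by move=> y; rewrite inE.
    by rewrite -(big_ord_widen n (fun=> 1%N) (ltnW (ltn_ord x))) sum1_card card_ord.
  by apply/subset_leq_card/subsetP=> y; rewrite !inE => /andP[].
have g_proof (x : 'I_n) : minn #|below x| k.-1 < n.
  by have := below_lt x; have := ltn_ord x; lia.
pose g := [ffun x => Ordinal (g_proof x)].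
have g_mono : {homo g : x y / (x <= y)%N}.
  move=> x y le_xy; rewrite !ffunE /=.
  have minS p q : p <= q -> minn p k.-1 <= minn q k.-1 by lia.
  apply: minS.
  apply/subset_leq_card/subsetP=> z; rewrite !inE => /andP[-> zx] /=.
  exact: leq_trans zx le_xy.
have below_k x : x \in A -> #|below x| < k.
  move=> xA; apply/proper_card/properP; split.
    by apply/subsetP=> z; rewrite inE => /andP[].
  by exists x; rewrite // inE ltnn andbF.
have gA x : x \in A -> g x = #|below x| :> nat.
  have minE p : p < k -> minn p k.-1 = p by lia.
  by move=> xA; rewrite ffunE /= minE ?below_k.
have g_smono x y : x \in A -> y \in A -> x < y -> g x < g y.
  move=> xA yA lt_xy; rewrite !gA //; apply/proper_card/properP; split.
    apply/subsetP=> z; rewrite !inE => /andP[-> zx] /=.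
    exact: ltn_trans zx lt_xy.
  by exists x; rewrite inE xA ?ltnn ?lt_xy.
have g_inj : {in A &, injective g}.
  move=> x y xA yA eq_g; apply: ord_inj; case: (ltngtP x y) => // lt_xy.
    by have := g_smono _ _ xA yA lt_xy; rewrite eq_g ltnn.
  by have := g_smono _ _ yA xA lt_xy; rewrite eq_g ltnn.
have fA x : f x \in A by apply: imset_f.
have im_g (j : 'I_n) : exists x, g (f x) == OD_cap k j.
  have : OD_cap k j \in [set g x | x in A].
    have -> : [set g x | x in A] = [set y : 'I_n | y < k].
      apply/eqP; rewrite eqEcard; apply/andP; split.
        apply/subsetP=> _ /imsetP[x xA ->]; rewrite inE gA //; exact: below_k.
      rewrite card_in_imset // -[X in _ <= X]/k.
      rewrite -sum1_card (eq_bigl (fun y : 'I_n => y < k)); last by move=> y; rewrite inE.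
      have le_kn : k <= n by rewrite -[n in leqRHS]card_ord max_card.
      by rewrite -(big_ord_widen n (fun=> 1%N) le_kn) sum1_card card_ord.
    by rewrite inE OD_capE; lia.
  by case/imsetP=> _ /imsetP[x _ ->] ->; exists x.
pose s := [ffun j => odflt j [pick x | g (f x) == OD_cap k j]].
have sE j : s j = odflt j [pick x | g (f x) == OD_cap k j] by rewrite ffunE.
have gfs j : g (f (s j)) = OD_cap k j.
  rewrite sE; case: pickP => [x /eqP //|no_x]; have [x hx] := im_g j.
  by have := no_x x; rewrite hx.
have s_eq i j : OD_cap k i = OD_cap k j -> s i = s j.
  move=> eq_ij; rewrite !sE eq_ij; case: pickP => //= no_x.
  by have [x hx] := im_g j; have := no_x x; rewrite hx.
have g_proof' : order_preserving g || order_reversing g.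
  by apply/orP; left; apply/order_preservingP.
have s_lt (i j : 'I_n) : i <= j -> s i = s j \/ g (f (s i)) < g (f (s j)).
  move=> le_ij; have [eq_ij|neq_ij] := eqVneq (OD_cap k i) (OD_cap k j).
    by left; apply: s_eq.
  right; rewrite !gfs; move: neq_ij; rewrite -val_eqE /= !OD_capE; lia.
have s_proof : order_preserving s || order_reversing s.
  apply/orP; case/orP: (OD_funP f).
    move=> /order_preservingP hf; left; apply/order_preservingP=> i j /s_lt[->|] //.
    by move=> lt; rewrite leqNgt; apply/negP=> /ltnW/hf/g_mono; rewrite leqNgt lt.
  move=> /order_reversingP hf; right; apply/order_reversingP=> i j /s_lt[->|] //.
  by move=> lt; rewrite leqNgt; apply/negP=> /ltnW/hf/g_mono; rewrite leqNgt lt.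
have capg x : OD_cap k (g x) = g x.
  by apply/ord_inj; rewrite OD_capE ffunE /=; lia.
exists (MkOD s_proof), (MkOD g_proof'); split; apply: OD_ext => x.
  by rewrite !OD_mulE /=; apply: g_inj; rewrite ?fA // gfs capg.
by rewrite !OD_mulE /= gfs.
Qed.

Lemma OD_J_factor r e f : 0 < n -> e \in OD_J n r -> f \in OD_J n r ->
  exists s t : OD n, f = s * e * t.
Proof.
move=> n_gt0; rewrite !inE => /eqP re /eqP rf.
have [s [g [fE fc]]] := OD_factor f n_gt0.
have [s' [g' [eE ec]]] := OD_factor e n_gt0.
rewrite rf -re -ec in fc; exists (f * s * g'), (s' * g * f).
rewrite -[LHS]fE -[X in _ * X]fE.
have -> : f * s * g * (f * s * g * f) = f * s * (g * f * s) * (g * f).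
  by rewrite !mulmA.
by rewrite fc !mulmA.
Qed.

Lemma Jclass_OD_J r (e : OD n) : 0 < n -> e \in OD_J n r -> Jclass e = OD_J n r.
Proof.
move=> n_gt0 eJ; apply/setP=> f; rewrite inE; apply/idP/idP => [|fJ]; last first.
  by apply/greenJP; split; apply: (@OD_J_factor r).
move: eJ; rewrite !inE => /eqP re.
case/greenJP => -[s [t fst]] [u [v euv]].
rewrite -re eqn_leq; apply/andP; split.
  by rewrite fst (leq_trans (OD_rank_mulr _ _)) ?OD_rank_mull.
by rewrite euv (leq_trans (OD_rank_mulr _ _)) ?OD_rank_mull.
Qed.

Lemma OD_J_has_idempotent r : 0 < r <= n ->
  exists e : idempotent_of (OD n), idem_val e \in OD_J n r.
Proof.
by move=> hr; exists (Idempotent (OD_cap_idem r)); rewrite inE OD_rank_cap.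
Qed.

Lemma OD_J_eggbox r e f : 0 < n -> e \in OD_J n r -> f \in OD_J n r ->
  exists g : OD n, greenR f g /\ greenL e g.
Proof.
move=> n_gt0; rewrite !inE => /eqP re /eqP rf.
have [s [g [fE fc]]] := OD_factor f n_gt0.
have [s' [g' [eE ec]]] := OD_factor e n_gt0.
rewrite rf -re -ec in fc; exists (f * s * (g' * e)).
split; [apply/greenRP | apply/greenLP]; split.
- by exists (s * (g' * e)); rewrite !mulmA.
- exists (s' * g * f).
  have -> : f * s * (g' * e) * (s' * g * f) = f * s * (g' * e * s') * (g * f).
    by rewrite !mulmA.
  by rewrite -fc !mulmA fE fE.
- by exists (f * s * g'); rewrite mulmA.
- exists (e * s' * g).
  have -> : e * s' * g * (f * s * (g' * e)) = e * s' * (g * f * s) * (g' * e).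
    by rewrite !mulmA.
  by rewrite fc !mulmA eE eE.
Qed.

Lemma OD_sandwich_reps_exist r (e : idempotent_of (OD n)) :
  0 < n -> idem_val e \in OD_J n r ->
  exists a b, sandwich_reps (OD_J n r) e a b.
Proof.
move=> n_gt0 eJ; have eLe := greenL_refl (idem_val e); have eRe := greenR_refl (idem_val e).
pose a (R : {set OD n}) : OD n :=
  if R == Rclass (idem_val e) then idem_val e else odflt (idem_val e) [pick x in R :&: Lclass (idem_val e)].
pose b (L : {set OD n}) : OD n :=
  if L == Lclass (idem_val e) then idem_val e else odflt (idem_val e) [pick x in Rclass (idem_val e) :&: L].
exists a, b; split; rewrite /a /b ?eqxx //.
  move=> R /imsetP[f fJ ->]; case: eqP => [->|_]; first by rewrite !inE eLe eRe.
  case: pickP => //= no_f; have [g [fg eg]] := OD_J_eggbox n_gt0 eJ fJ.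
  by have := no_f g; rewrite !inE fg eg.
move=> L /imsetP[f fJ ->]; case: eqP => [->|_]; first by rewrite !inE eLe eRe.
case: pickP => //= no_f; have [g [eg fg]] := OD_J_eggbox n_gt0 fJ eJ.
by have := no_f g; rewrite !inE fg eg.
Qed.

End OD.

(* Main.v *)
Require Import Defs.
From HB Require Import structures.
From mathcomp Require Import all_boot all_order all_fingroup all_algebra.

(** In [J_k] an L-class is a partition of the chain into [k] intervals, an
    R-class is a [k]-subset, and the sandwich matrix has a nonzero entry, which
    is then an element of the group, exactly when the subset is a transversal
    of the partition.  Pick for each partition the column indexed by the set of
    minima of its blocks.  If the minima [m'_1 < ... < m'_k] of a second
    partition form a transversal of a partition with minima
    [m_1 < ... < m_k], then [m_i <= m'_i] for all [i]; so the sum of the minima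
    strictly increases unless the two partitions agree.  Hence the chosen
    columns form a square matrix that is triangular, for the order given by the
    sum of the minima, and whose diagonal entries are group elements, thus
    units of the group algebra.  Such a matrix has a right inverse
    ([triangular_right_invertible]), and so has the whole sandwich matrix, for
    every field and every choice of representatives.

    The set of minima is handled through the map [min_fiber f] sending a point
    to the minimum of its fibre under [f].  It is an order-preserving
    idempotent which is L-related to [f] ([min_fiber_greenL]), and it lies below
    the identity; the comparison of minima ([min_weight_lt]) is obtained from
    the equations which L- and R-related idempotents satisfy. *)

Set Implicit Arguments.
Unset Strict Implicit.
Unset Printing Implicit Defensive.
Import Order.TTheory GRing.Theory.

(** * Triangular matrices and group elements *)

Section Triangular.
Local Open Scope ring_scope.

(** Back substitution: by induction on the weight of [l], the [l]-th unit column
    is [P] times some column, since the [j]-th column of [P], scaled by [u], is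
    this unit column up to a combination of unit columns of smaller weight.
    Scalars act on the right as the ring need not be commutative. *)
Lemma triangular_right_invertible (A : nzRingType) (m p : nat)
    (P : 'M[A]_(m, p)) (w : 'I_m -> nat) :
  (forall l, exists (j : 'I_p) (u : A), P l j * u = 1 /\
     forall l', l' != l -> P l' j != 0 -> (w l' < w l)%N) ->
  right_invertible P.
Proof.
move=> hP; have unit_col l : exists v : 'cV[A]_p, P *m v == delta_mx l 0.
  have [d] := ubnP (w l); elim: d l => // d IHd l le_wd.
  have [j [u [Pu1 ltP]]] := hP l.
  have [x hx] : exists x : 'I_m -> 'cV[A]_p, forall l', l' != l ->
      (P *m x l' = delta_mx l' 0 *m (P l' j * u)%:M).
    suff hx l' : exists v : 'cV[A]_p, (l' != l) ==>
        (P *m v == delta_mx l' 0 *m (P l' j * u)%:M).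
      exists (fun l' => xchoose (hx l')) => l' ne_l.
      by have /implyP/(_ ne_l)/eqP := xchooseP (hx l').
    have [_|ne_l] := eqVneq l' l; first by exists 0.
    have [P0|Pn0] := eqVneq (P l' j) 0.
      by exists 0; rewrite P0 mul0r mulmx0 raddf0 mulmx0 eqxx.
    have [|v /eqP Pv] := IHd l'; first exact: leq_trans (ltP _ ne_l Pn0) le_wd.
    by exists (v *m (P l' j * u)%:M); rewrite mulmxA Pv eqxx.
  exists (delta_mx j 0 *m u%:M - \sum_(l' | l' != l) x l').
  rewrite mulmxBr mulmx_sumr (eq_bigr _ hx) mulmxA.
  apply/eqP/matrixP=> i i0; rewrite ord1 !mxE big_ord1 !mxE summxE mulr1n.
  have -> : \sum_(k < p) P i k * (delta_mx j 0 : 'cV_p) k 0 = P i j.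
    rewrite (bigD1 j) //= mxE !eqxx mulr1 big1 ?addr0 // => k /negPf ne_kj.
    by rewrite mxE ne_kj mulr0.
  have term l' : (delta_mx l' 0 *m (P l' j * u)%:M : 'cV_m) i 0 =
                 (i == l')%:R * (P l' j * u).
    by rewrite mxE big_ord1 !mxE eqxx andbT mulr1n.
  rewrite (eq_bigr _ (fun l' _ => term l')) eqxx andbT.
  have [->|ne_il] := eqVneq i l.
    rewrite Pu1 big1 ?subr0 // => l' ne_l.
    by rewrite eq_sym (negPf ne_l) mul0r.
  rewrite (bigD1 i) //= eqxx mul1r big1 ?addr0 ?subrr // => l' /andP[_ ne_l'].
  by rewrite eq_sym (negPf ne_l') mul0r.
exists (\matrix_(j, l) xchoose (unit_col l) j 0).
apply/matrixP=> i l; rewrite !mxE.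
have /eqP/matrixP/(_ i 0) := xchooseP (unit_col l).
by rewrite !mxE eqxx andbT => <-; apply: eq_bigr => j _; rewrite mxE.
Qed.

Lemma galg_eltM (K : fieldType) (G : finGroupType) (g h : G) :
  galg_elt K g * galg_elt K h = galg_elt K (g * h)%g.
Proof.
apply/ffunP=> x; rewrite !ffunE (bigD1 g) //= big1 => [|y ne_yg].
  by rewrite !ffunE eqxx mul1r addr0 -(inj_eq (mulgI g)) mulKVg.
by rewrite ffunE (negPf ne_yg) mul0r.
Qed.

End Triangular.

(** * The idempotent of block minima *)

Lemma greenL_Lclass (M : finMonoidType) (x y : M) :
  greenL x y -> Lclass x = Lclass y.
Proof.
move=> xy; apply/setP=> z; rewrite !inE; apply/idP/idP; apply: greenL_trans => //.
by rewrite greenL_sym.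
Qed.

Section MinFiber.
Context (n : nat).
Implicit Types f g : OD n.
Local Open Scope finmonoid_scope.

Lemma OD_rank_greenL f g : greenL f g -> OD_rank f = OD_rank g.
Proof.
case/greenLP=> -[s gE] [t fE]; apply/eqP; rewrite eqn_leq; apply/andP; split.
  by rewrite fE OD_rank_mull.
by rewrite gE OD_rank_mull.
Qed.

Definition min_fiber_fun f (i : 'I_n) : 'I_n :=
  [arg min_(j < i | f j == f i) j].

Lemma min_fiber_funP f i :
  f (min_fiber_fun f i) = f i /\
  forall j, f j = f i -> (min_fiber_fun f i <= j)%N.
Proof.
rewrite /min_fiber_fun; case: arg_minnP => // m /eqP fm min_m.
by split=> // j fj; apply: min_m; rewrite fj.
Qed.

(** The fibres of a monotone map are intervals: if the minimum of the fibre of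
    [j] lay below that of [i], for [i <= j], it would lie below [i] as well,
    and [i] would be caught between two points of that fibre. *)
Lemma min_fiber_fun_homo f : {homo min_fiber_fun f : i j / (i <= j)%N}.
Proof.
move=> i j le_ij.
have [fmi mini] := min_fiber_funP f i; have [fmj minj] := min_fiber_funP f j.
rewrite leqNgt; apply/negP=> lt_ji.
have le_ji : (min_fiber_fun f j <= i)%N := leq_trans (ltnW lt_ji) (mini _ erefl).
suff f_ij : f j = f i by have := mini _ (etrans fmj f_ij); rewrite leqNgt lt_ji.
apply/ord_inj/eqP; rewrite eqn_leq; case/orP: (OD_funP f).
  by move=> /order_preservingP hf; rewrite -{1}fmj !hf.
by move=> /order_reversingP hf; rewrite -{2}fmj !hf.
Qed.

Lemma min_fiber_proof f : let h := [ffun i => min_fiber_fun f i] in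
  order_preserving h || order_reversing h.
Proof.
apply/orP; left; apply/order_preservingP=> i j.
by rewrite !ffunE; apply: min_fiber_fun_homo.
Qed.

Definition min_fiber f : OD n := MkOD (min_fiber_proof f).

Lemma min_fiberE f i : min_fiber f i = min_fiber_fun f i.
Proof. by rewrite ffunE. Qed.

Lemma min_fiber_le f i : (min_fiber f i <= i)%N.
Proof. by rewrite min_fiberE; have [_ ->] := min_fiber_funP f i. Qed.

Lemma min_fiber_eq f i j : f i = f j -> min_fiber f i = min_fiber f j.
Proof.
move=> f_ij; rewrite !min_fiberE.
have [fmi mini] := min_fiber_funP f i; have [fmj minj] := min_fiber_funP f j.
by apply/ord_inj/eqP; rewrite eqn_leq mini ?minj // ?fmi ?fmj.
Qed.

Lemma min_fiberK f : f * min_fiber f = f.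
Proof.
by apply: OD_ext => i; rewrite OD_mulE min_fiberE; have [] := min_fiber_funP f i.
Qed.

Lemma min_fiber_idem f : min_fiber f * min_fiber f = min_fiber f.
Proof.
by apply: OD_ext => i; rewrite OD_mulE; apply: min_fiber_eq; rewrite -OD_mulE min_fiberK.
Qed.

Lemma min_fiber_homo f : {homo min_fiber f : i j / (i <= j)%N}.
Proof. by move=> i j; rewrite !min_fiberE; apply: min_fiber_fun_homo. Qed.

(** [f] is regular, so that [h * f] is an idempotent with the kernel of [f] for
    some [h]; absorbing it on the right leaves [min_fiber f] unchanged. *)
Lemma min_fiber_greenL f : (0 < n)%N -> greenL f (min_fiber f).
Proof.
move=> n_gt0; have [s [g [fsgf _]]] := OD_factor f n_gt0.
apply/greenLP; split; last by exists f; rewrite min_fiberK.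
exists (min_fiber f * s * g); apply: OD_ext => i; rewrite -!mulmA OD_mulE.
by apply: min_fiber_eq; rewrite -OD_mulE !mulmA fsgf.
Qed.

(** Both maps send a point to the largest element below it of their common
    image. *)
Lemma min_fiber_greenR_eq f g :
  greenR (min_fiber f) (min_fiber g) -> min_fiber f = min_fiber g.
Proof.
suff le_of f' g' i : greenR (min_fiber f') (min_fiber g') ->
    (min_fiber g' i <= min_fiber f' i)%N.
  move=> fRg; apply: OD_ext => i; apply/ord_inj/eqP.
  by rewrite eqn_leq !le_of // greenR_sym.
move=> fRg; have <- := idem_greenR (min_fiber_idem f') fRg.
by rewrite OD_mulE min_fiber_homo ?min_fiber_le.
Qed.

Definition min_weight f : nat :=
  \sum_(i in [set min_fiber f i | i : 'I_n]) (i : nat).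

(** An idempotent [e0] with kernel that of [f] and image the set of minima for
    [g] maps the minima for [f] bijectively onto the minima for [g] and keeps
    each of them in its block, so moves none of them down.  If none is moved, both sets of minima
    coincide, and they determine the kernels. *)
Lemma min_weight_lt f g : (0 < n)%N ->
  has_idempotent (Rclass (min_fiber g) :&: Lclass f) -> ~~ greenL f g ->
  (min_weight f < min_weight g)%N.
Proof.
move=> n_gt0 /existsP[e0 /andP[]]; rewrite !inE => /andP[gRe fLe] /eqP ee nfLg.
have fLm := min_fiber_greenL f n_gt0.
have eLm : greenL e0 (min_fiber f) by apply: greenL_trans fLm; rewrite greenL_sym.
have mLe : greenL (min_fiber f) e0 by rewrite greenL_sym.
have me : min_fiber f * e0 = min_fiber f := idem_greenL ee eLm.
have em : e0 * min_fiber f = e0 := idem_greenL (min_fiber_idem f) mLe.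
have ge : min_fiber g * e0 = e0 := idem_greenR (min_fiber_idem g) gRe.
have eg : e0 * min_fiber g = min_fiber g.
  by apply: idem_greenR => //; rewrite greenR_sym.
have meE i : min_fiber f (e0 i) = min_fiber f i by rewrite -OD_mulE me.
pose A := [set min_fiber f i | i : 'I_n].
have minA i : i \in A -> min_fiber f i = i.
  by case/imsetP=> j _ ->; rewrite -OD_mulE min_fiber_idem.
have imB : [set min_fiber g i | i : 'I_n] = e0 @: A.
  apply/setP=> i; apply/imsetP/imsetP=> [[j _ ->]|[j _ ->]].
    exists (min_fiber f (min_fiber g j)); first exact: imset_f.
    by rewrite -(OD_mulE e0) em -OD_mulE eg.
  by exists (e0 j); rewrite // -OD_mulE ge.
have e_inj : {in A &, injective e0}.
  by move=> i j iA jA eq_e; rewrite -(minA i) // -(minA j) // -meE eq_e meE.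
have e_ge i : i \in A -> (i <= e0 i)%N.
  by move=> iA; rewrite -{1}(minA i iA) -meE min_fiber_le.
have wg : min_weight g = \sum_(i in A) (e0 i : nat).
  by rewrite /min_weight imB big_imset.
have [le_w eq_w] : min_weight f <= \sum_(i in A) (e0 i : nat)
    ?= iff [forall (i | i \in A), i == e0 i :> nat].
  by apply: leqif_sum => i /e_ge le_i; apply/leqif_eq.
rewrite wg ltn_neqAle le_w eq_w andbT; apply: contra nfLg => /forall_inP e_fix.
have e_id i : i \in A -> e0 i = i by move=> /e_fix/eqP/ord_inj.
have e_min : e0 = min_fiber f.
  by rewrite -em; apply: OD_ext => i; rewrite OD_mulE e_id // imset_f.
have mfg : min_fiber f = min_fiber g.
  by apply: min_fiber_greenR_eq; rewrite greenR_sym -e_min.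
by rewrite (greenL_trans fLm) // mfg greenL_sym min_fiber_greenL.
Qed.

End MinFiber.

(** * The sandwich matrix *)

Theorem lemma3p2 (n : nat) (K : fieldType) (hn : (1 <= n)%N) (k : nat)
    (hk : (1 <= k <= n)%N) (e : idempotent_of (OD n))
    (he : idem_val e \in OD_J n k) (a b : {set OD n} -> OD n)
    (hab : sandwich_reps (OD_J n k) e a b) :
  right_invertible (sandwich_mx K (OD_J n k) e a b).
Proof.
pose J := OD_J n k.
have bE L : L \in Lclasses J -> b L \in J /\ L = Lclass (b L).
  move=> LJ; have := reps_b hab LJ; case/imsetP: LJ => x xJ ->.
  rewrite !inE => /andP[_ xLb]; split; last exact: greenL_Lclass.
  by move: xJ; rewrite inE (OD_rank_greenL xLb).
apply: (@triangular_right_invertible _ _ _ _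
         (fun l => min_weight (b (enum_val l)))) => l.
have [bJ LE] := bE _ (enum_valP l); set f := b _ in bJ LE.
have fLm := min_fiber_greenL f hn.
have RJ : Rclass (min_fiber f) \in Rclasses J.
  by apply: imset_f; move: bJ; rewrite !inE (OD_rank_greenL fLm).
(* The blocks of [f] and their minima meet in a group H-class, because
   [min_fiber f] is an idempotent lying in it: the diagonal entry is a unit. *)
pose j := enum_rank_in RJ (Rclass (min_fiber f)).
have jE : enum_val j = Rclass (min_fiber f) by rewrite enum_rankK_in.
have idem_j : has_idempotent (enum_val j :&: enum_val l).
  apply/existsP; exists (min_fiber f).
  by rewrite jE LE !inE greenR_refl fLm min_fiber_idem eqxx.
set x := insubd (max_subgroup_one e) (mulm (b (enum_val l)) (a (enum_val j))).
exists j, (galg_elt K x^-1%g); split.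
  by rewrite mxE /= idem_j -/x galg_eltM mulgV.
move=> l' ne_l; have [_ LE'] := bE _ (enum_valP l').
rewrite mxE /=; case: ifP => [|_]; last by rewrite eqxx.
rewrite jE {1}LE' => idem_l' _; apply: min_weight_lt => //.
apply: contra ne_l => bLb; apply/eqP/enum_val_inj.
by rewrite LE' LE; apply: greenL_Lclass.
Qed.
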